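(* There is a universal numerical constant $C>0$ such that the following holds. Let $T\ge1$, $d\ge1$ be integers, $T_0\ge1$ a real number, $0<\delta<1$. Let $(\mathcal{F}_t)_{t\ge-1}$ be a filtration and, for $t=0,\dots,T-1$, let $a_t$ be an $\mathcal{F}_{t-1}$-measurable unit vector in $\mathbb{R}^d$ and $u_t$ an $\mathcal{F}_t$-measurable random vector in $\mathbb{R}^d$ such that, conditionally on $\mathcal{F}_{t-1}$, $u_t\sim\mathcal{N}(0,I_d)$ is independent of the past. Define $$w_t:=\frac1{t+T_0},\qquad \zeta_t:=\frac{(u_t^\top a_t)^2}{\|u_t\|^2},\qquad t=0,\dots,T-1,$$ $$J_T:=1+\Big\lceil\log_2\Big(\frac{T(T+T_0)}{T_0}\Big)\Big\rceil,\qquad \Gamma_T^{\rm scan}(\delta):=1+\log\frac1\delta+\log J_T+\log(e+T_0).$$ Then, with probability at least $1-\delta$, the following estimates hold simultaneously. (1) For every interval $0\le a\le b\le T-1$, $$\sum_{t=a}^bw_t\zeta_t\ge\frac1{2d}\sum_{t=a}^bw_t-\frac{C}{dT_0}\Gamma_T^{\rm scan}(\delta).$$ (2) For every $1\le K\le T$, $$d\sum_{t=0}^{K-1}w_t\zeta_t\le C\big(1+\log(T+T_0)\big)+\frac{C}{T_0}\Gamma_T^{\rm scan}(\delta).$$ Consequently, for every $1\le K\le T$ and every $k=-1,0,\dots,K-2$, with $W_{K,k}:=\sum_{t=k+1}^{K-1}\frac1{t+T_0}$, $$\sum_{t=k+1}^{K-1}\frac{\zeta_t}{t+T_0}\ge\frac{W_{K,k}}{2d}-\frac{C}{dT_0}\Gamma_T^{\rm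 scan}(\delta).$$
   Context: $\|\cdot\|$ is the Euclidean norm. $\zeta_t$ is defined almost surely (off the null event $u_t=0$). *)

(* Defs.v *)
From HB Require Import structures.
From mathcomp Require Import all_boot all_order all_algebra.
From mathcomp Require Import all_classical all_reals all_analysis.
Set Implicit Arguments.
Unset Strict Implicit.
Unset Printing Implicit Defensive.
Import Order.TTheory GRing.Theory Num.Theory.
Local Open Scope classical_set_scope.
Local Open Scope ring_scope.

(* Vectors of R^d are d-tuples of reals: d.-tuple R carries the product Borel
   sigma-algebra, and, unlike 'rV[R]_d, no competing sup norm. *)
Section euclidean.
Context {R : realType} {d : nat}.
Implicit Types x y : d.-tuple R.

Definition dotp x y : R := \sum_(i < d) tnth x i * tnth y i.

Definition enorm x : R := Num.sqrt (\sum_(i < d) tnth x i ^+ 2).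

(* Since r / 0 = 0, zeta u a = 0 at u = 0, a point of Gaussian measure 0. *)
Definition zeta (u a : d.-tuple R) : R := dotp u a ^+ 2 / enorm u ^+ 2.

End euclidean.

(* N(0, I_n), the n-fold product of the one-dimensional law N(0, 1), built one
   coordinate at a time. *)
Fixpoint std_gaussian {R : realType} (n : nat) :
    set (n.-tuple R) -> \bar R :=
  match n with
  | 0 => fun A => \d_[tuple] A
  | n'.+1 => fun A =>
      (\int[normal_prob 0 1]_x std_gaussian [set v | A (cons_tuple x v)])%E
  end.

Section probability_notions.
Context {R : realType} {disp : measure_display} {Omega : measurableType disp}.
Variable P : probability Omega R.

(* Indices are shifted by one: F n is the sigma-algebra at time n - 1. *)
Definition filtration (F : nat -> set (set Omega)) : Prop :=
  [/\ forall n, sigma_algebra setT (F n),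
      forall n, F n `<=` measurable &
      forall m n, (m <= n)%N -> F m `<=` F n].

Context {disp' : measure_display} {V : measurableType disp'}.
Implicit Types (G : set (set Omega)) (X : Omega -> V).

Definition adapted_to G X : Prop :=
  forall B : set V, measurable B -> G (X @^-1` B).

Definition has_law X (mu : set V -> \bar R) : Prop :=
  forall B : set V, measurable B -> P (X @^-1` B) = mu B.

Definition independent_of G X : Prop :=
  forall (A : set Omega) (B : set V), G A -> measurable B ->
    (P (A `&` X @^-1` B) = P A * P (X @^-1` B))%E.

End probability_notions.

Section scan_quantities.
Context {R : realType}.

Definition w (T0 : R) (t : nat) : R := (t%:R + T0)^-1.

Definition log2 (x : R) : R := ln x / ln 2.

Definition J (T : nat) (T0 : R) : R :=
  1 + (Num.ceil (log2 (T%:R * (T%:R + T0) / T0)))%:~R.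

Definition Gamma_scan (T : nat) (T0 delta : R) : R :=
  1 + ln (1 / delta) + ln (J T T0) + ln (expR 1 + T0).

Definition W (T0 : R) (K : nat) (k : int) : R :=
  \sum_(0 <= t < K | k + 1 <= t%:Z) 1 / (t%:R + T0).

End scan_quantities.

(* Main.v *)
Require Import Defs.
From HB Require Import structures.
From mathcomp Require Import all_boot all_order all_algebra.
From mathcomp Require Import all_classical all_reals all_analysis.
From mathcomp Require Import measurable_realfun ring lra zify.
Set Implicit Arguments.
Unset Strict Implicit.
Unset Printing Implicit Defensive.
Import Order.TTheory GRing.Theory Num.Theory.
Local Open Scope classical_set_scope.
Local Open Scope ring_scope.

(** Conditionally on the past, zeta_t is the squared cosine of the angle between
a fixed unit vector and a standard Gaussian vector, so it has mean 1/d and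
fluctuations of order 1/d. Hence, for a universal eta, the variables
exp (x (1/2 - d zeta_t)), with 0 <= x <= eta, and exp (x (d zeta_t - 96)), with
0 <= x <= 1/32, have conditional expectation at most 1 ([zeta_lower_mgf],
[zeta_upper_mgf]), and their products along the path are supermartingales.

For a fixed left end i, take x = eta w_t / w_i for t >= i. As w decreases, x
never exceeds eta, and the maximal inequality ([ville_inequality]) controls all
right ends j at once: outside an event of probability at most p_i,
eta / w_i * sum_(i <= t <= j) w_t (1/2 - d zeta_t) < ln (1 / p_i). The levels
p_i = delta / (2 (i+1) (i+2)) sum up to at most delta / 2, and they cost only
w_i ln (1 / p_i) = O (Gamma / T0), since ln (e + x) / x decreases in x = i + T0
([start_confidence_cost]). Thus neither the union over i nor the one over j
loses more than Gamma allows. The upper bound is a single use of the maximal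
inequality, with x = T0 w_t / 32, together with the harmonic sum of the weights.

The two moment bounds hold uniformly over unit vectors a without any appeal to
the rotation invariance of the Gaussian law. With X = u.a and r = |u|^2, the
only integrals needed are those of exp (c X^2 - y r), which an induction on the
dimension evaluates, one coordinate at a time ([integral_gauss_quad]). The ratio
zeta = X^2 / r is compared pointwise with such exponentials: from above by
splitting on r >= d/4 ([expR_zeta_le]), and from below through
1 / r >= e y exp (- y r) with y = 1/d ([zeta_ge_gauss]). The lower comparison
retains nearly the fraction e (1 + 2/d)^(- d/2 - 1) of the mean 1/d, which is at
least its value e / sqrt 27 > 1/2 in dimension one; this is what leaves room for
the factor 1/2 in the theorem.

Conditional expectations enter only through [integral_freeze]: if u is
independent of a sigma-algebra G, then (om, u om) has a product law on
(Omega, G) x R^d, so Tonelli integrates u out with the past held fixed. *)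

(** * The standard Gaussian law as an iterated product *)

Section gauss_measure.
Context {R : realType}.

(** The first coordinate lives in the copy of R on which the normal law is
defined; that copy has the same measurable sets, under another display. *)
Definition cons_pair n (p : measurableTypeR R * n.-tuple R) :
  n.+1.-tuple R :=
  cons_tuple p.1 p.2.

Lemma measurable_cons_pair n : measurable_fun setT (@cons_pair n).
Proof.
have mf : measurable_fun setT (fst : measurableTypeR R * n.-tuple R -> R).
  exact: (@measurable_fst _ _ (measurableTypeR R)).
exact: (@measurable_cons _ _ _ R fst n snd mf measurable_snd).
Qed.

HB.instance Definition _ n :=
  isMeasurableFun.Build _ _ _ _ (@cons_pair n) (@measurable_cons_pair n).

(** N(0, I_n) as a bundled probability, so that integrals against it and product
measures built from it make sense; see [std_gaussianE]. *)
Fixpoint gauss n : probability (n.-tuple R) R :=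
  match n with
  | 0 => \d_[tuple]
  | n'.+1 => distribution (normal_prob 0 1 \x gauss n')%E (@cons_pair n')
  end.

Lemma std_gaussianE n (A : set (n.-tuple R)) :
  measurable A -> std_gaussian A = gauss n A.
Proof.
elim: n A => [|n IHn] A mA //=.
rewrite /distribution /pushforward /product_measure1.
apply: eq_integral => x _; rewrite IHn /=; last first.
  rewrite -[X in measurable X]setTI; apply: measurable_cons => //.
congr (gauss n _); apply/seteqP; split=> v /=; by rewrite /xsection /= inE.
Qed.

Lemma integral_gauss_cons n (f : n.+1.-tuple R -> R) :
  measurable_fun setT f -> (forall v, 0 <= f v) ->
  (\int[gauss n.+1]_v (f v)%:E =
   \int[normal_prob 0 1]_x \int[gauss n]_v (f (cons_tuple x v))%:E)%E.
Proof.
move=> mf f0.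
have mef : measurable_fun setT (EFin \o f) by apply/measurable_EFinP.
rewrite /= (ge0_integral_distribution _ mef)//.
rewrite fubini_tonelli1//=.
- apply: measurableT_comp => //; exact: measurable_cons_pair.
- by move=> x; rewrite /= lee_fin.
Qed.

(** The density is a version of the Radon-Nikodym derivative with respect to
Lebesgue measure. *)
Lemma ge0_integral_normal_prob (m s : R) (f : R -> \bar R) :
  measurable_fun setT f -> (forall x, (0 <= f x)%E) ->
  (\int[normal_prob m s]_x f x =
   \int[lebesgue_measure]_x (f x * (normal_pdf m s x)%:E))%E.
Proof.
move=> mf f0.
have dom := normal_prob_dominates m s.
have mpdf : measurable_fun setT
    (fun x : measurableTypeR R => (normal_pdf m s x)%:E).
  by apply/measurable_EFinP; exact: measurable_normal_pdf.
have intRN := Radon_Nikodym_SigmaFinite.f_integrable dom.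
rewrite -(Radon_Nikodym_SigmaFinite.change_of_variables dom f0 measurableT mf).
apply: ae_eq_integral => //.
- by apply: emeasurable_funM => //; exact: (measurable_int _ intRN).
- exact: emeasurable_funM.
- apply: ae_eqe_mul2l; apply: integral_ae_eq => //.
  move=> A _ mA.
  by rewrite -(Radon_Nikodym_SigmaFinite.f_integral dom mA).
Qed.

End gauss_measure.

(** * Gaussian integrals of exponentials of quadratic forms *)

Section gauss_quad.
Context {R : realType}.

(** Completing the square: the exponential of a quadratic turns the density of
N(0, 1) into a multiple of another normal density, of variance 1 / D. *)
Lemma expR_mul_normal_pdf (c a m y x : R) :
  let D := 1 + 2 * y - 2 * c * a ^+ 2 in 0 < D ->
  expR (c * (x * a + m) ^+ 2 - y * x ^+ 2) * normal_pdf 0 1 x =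
  (Num.sqrt D)^-1 * expR (c * m ^+ 2 * (1 + 2 * y) / D) *
  normal_pdf (2 * c * a * m / D) (Num.sqrt D)^-1 x.
Proof.
move=> D D0.
have sD0 : Num.sqrt D != 0 by rewrite gt_eqF// sqrtr_gt0.
rewrite !normal_pdfE ?invr_eq0 ?oner_eq0// /normal_peak /normal_fun.
have -> : (Num.sqrt D)^-1 ^+ 2 = D^-1 by rewrite exprVn sqr_sqrtr// ltW.
have -> : Num.sqrt (D^-1 * pi *+ 2) = (Num.sqrt D)^-1 * Num.sqrt (pi *+ 2).
  by rewrite -mulrnAr sqrtrM ?invr_ge0 ?sqrtrV// ltW.
rewrite expr1n mul1r invfM invrK.
rewrite [LHS]mulrCA [RHS](_ : _ = (Num.sqrt (pi *+ 2))^-1 *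
  (expR (c * m ^+ 2 * (1 + 2 * y) / D) *
  expR (- (x - 2 * c * a * m / D) ^+ 2 / (D^-1 *+ 2)))); last first.
  set P := (Num.sqrt (pi *+ 2))^-1; set e1 := expR _; set e2 := expR _.
  by move: sD0; set q := Num.sqrt D => q0; field.
rewrite -!expRD; congr (_ * _); congr expR.
have Dn0 : D != 0 by rewrite gt_eqF.
move: Dn0; rewrite /D => Dn0; field.
by rewrite Dn0.
Qed.

Lemma integral_normal_quad (c a m y : R) :
  let D := 1 + 2 * y - 2 * c * a ^+ 2 in 0 < D ->
  (\int[normal_prob 0 1]_x (expR (c * (x * a + m) ^+ 2 - y * x ^+ 2))%:E =
   ((Num.sqrt D)^-1 * expR (c * m ^+ 2 * (1 + 2 * y) / D))%:E)%E.
Proof.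
move=> D D0.
rewrite ge0_integral_normal_prob//; last first.
  apply/measurable_EFinP; apply: measurableT_comp => //.
  apply: measurable_funB.
    apply: measurable_funM => //; apply: measurable_funX.
    apply: measurable_funD => //.
    exact: measurable_funM.
  apply: measurable_funM => //; exact: measurable_funX.
under eq_integral => x _.
  rewrite -EFinM expR_mul_normal_pdf// EFinM.
  over.
rewrite ge0_integralZl//=.
- by rewrite integral_normal_pdf mule1.
- by apply/measurable_EFinP; exact: measurable_normal_pdf.
- by move=> x _; rewrite lee_fin normal_pdf_ge0.
Qed.

End gauss_quad.

Section gauss_moments.
Context {R : realType}.

Definition sqn n (v : n.-tuple R) : R := \sum_(i < n) tnth v i ^+ 2.

Lemma sqn_ge0 n (v : n.-tuple R) : 0 <= sqn v.
Proof. by apply: sumr_ge0 => i _; exact: sqr_ge0. Qed.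

Lemma sqn_cons n x (v : n.-tuple R) : sqn (cons_tuple x v) = x ^+ 2 + sqn v.
Proof.
rewrite /sqn big_ord_recl tnth0; congr (_ + _).
by apply: eq_bigr => i _; rewrite tnthS.
Qed.

Lemma dotp_cons n x y (v b : n.-tuple R) :
  dotp (cons_tuple x v) (cons_tuple y b) = x * y + dotp v b.
Proof.
rewrite /dotp big_ord_recl !tnth0; congr (_ + _).
by apply: eq_bigr => i _; rewrite !tnthS.
Qed.

Lemma measurable_fun_dotp d (T : measurableType d) n (f g : T -> n.-tuple R) :
  measurable_fun setT f -> measurable_fun setT g ->
  measurable_fun setT (fun x => dotp (f x) (g x)).
Proof.
move=> /measurable_fun_tnthP mf /measurable_fun_tnthP mg.
by apply: measurable_sum => i; apply: measurable_funM; [exact: mf|exact: mg].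
Qed.

Lemma measurable_fun_sqn d (T : measurableType d) n (f : T -> n.-tuple R) :
  measurable_fun setT f -> measurable_fun setT (fun x => sqn (f x)).
Proof.
move=> /measurable_fun_tnthP mf.
by apply: measurable_sum => i; apply: measurable_funX; exact: mf.
Qed.

Lemma measurable_gauss_quad n (a : n.-tuple R) (c m y : R) :
  measurable_fun setT
    (fun v : n.-tuple R => expR (c * (dotp v a + m) ^+ 2 - y * sqn v)).
Proof.
apply: measurableT_comp => //; apply: measurable_funB.
  apply: measurable_funM => //; apply: measurable_funX.
  by apply: measurable_funD => //; exact: measurable_fun_dotp.
by apply: measurable_funM => //; exact: measurable_fun_sqn.
Qed.

(** Induction on the dimension. Integrating out all coordinates but the first
leaves an exponential of the same shape, with c replaced by c b / D' where D' is
the determinant factor of the shorter vector; this is why the shift m has to be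
part of the statement. *)
Lemma integral_gauss_quad n (a : n.-tuple R) (c m y : R) :
  let b := 1 + 2 * y in let D := b - 2 * c * sqn a in 0 < b -> 0 < D ->
  (\int[gauss n]_v (expR (c * (dotp v a + m) ^+ 2 - y * sqn v))%:E =
   ((Num.sqrt b) ^- n * Num.sqrt (b / D) * expR (c * m ^+ 2 * b / D))%:E)%E.
Proof.
move=> b D b0; rewrite {}/D; elim: n a m => [|n IHn] a m D0.
  rewrite /= integral_dirac//; last first.
    by apply/measurable_EFinP; exact: measurable_gauss_quad.
  rewrite diracE mem_set// mul1e.
  rewrite /dotp /sqn !big_ord0 in D0 *.
  rewrite expr0 invr1 mul1r mulr0 subr0 add0r mulr0 subr0 divff ?gt_eqF//.
  by rewrite sqrtr1 mul1r mulfK ?gt_eqF.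
case/tupleP: a D0 => a1 a.
have -> : [tuple of a1 :: a] = cons_tuple a1 a by [].
rewrite sqn_cons => D0.
set D := b - _ in D0 *.
pose D' := b - 2 * c * sqn a.
have DE : D = D' - 2 * c * a1 ^+ 2 by rewrite /D /D'; ring.
(* For c < 0 the bound comes from b, as dropping a coordinate lowers D. *)
have D'0 : 0 < D'.
  have [c0|/ltW c0] := leP 0 c.
    by rewrite (lt_le_trans D0)// DE lerBlDr lerDl mulr_ge0 ?sqr_ge0// mulr_ge0.
  rewrite (lt_le_trans b0)// lerDl -mulNr mulr_ge0// ?sqn_ge0//.
  by rewrite oppr_ge0 mulr_ge0_le0.
rewrite integral_gauss_cons; last 2 first.
- exact: measurable_gauss_quad.
- by move=> v; exact: expR_ge0.
under eq_integral => x _.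
  under eq_integral => v _.
    rewrite dotp_cons sqn_cons.
    rewrite (_ : c * _ - _ = - y * x ^+ 2 +
      (c * (dotp v a + (x * a1 + m)) ^+ 2 - y * sqn v)); last by ring.
    rewrite expRD EFinM.
    over.
  rewrite ge0_integralZl//=; last first.
    by apply/measurable_EFinP; exact: measurable_gauss_quad.
  rewrite IHn// -EFinM.
  rewrite (_ : expR _ * _ = Num.sqrt b ^- n * Num.sqrt (b / D') *
    expR ((c * b / D') * (x * a1 + m) ^+ 2 - y * x ^+ 2)); last first.
    rewrite [LHS]mulrCA -expRD; congr (_ * _); congr expR.
    by rewrite /D'; ring.
  rewrite EFinM.
  over.
have D1E : 1 + 2 * y - 2 * (c * b / D') * a1 ^+ 2 = b * D / D'.
  by rewrite -/b DE; field; rewrite gt_eqF.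
have D10 : 0 < b * D / D' by rewrite divr_gt0// mulr_gt0.
rewrite ge0_integralZl//=; last first.
  apply/measurable_EFinP; apply: measurableT_comp => //.
  apply: measurable_funB.
    apply: measurable_funM => //; apply: measurable_funX.
    apply: measurable_funD => //.
    exact: measurable_funM.
  apply: measurable_funM => //; exact: measurable_funX.
rewrite integral_normal_quad D1E// -EFinM; congr EFin.
rewrite mulrA; congr (_ * _); last congr expR; last first.
  by rewrite -/b; field; rewrite !gt_eqF.
have -> : Num.sqrt (b / D') =
    Num.sqrt (b * D / D') * ((Num.sqrt b)^-1 * Num.sqrt (b / D)).
  rewrite -sqrtrV ?(ltW b0)// -sqrtrM ?invr_ge0 ?(ltW b0)//.
  rewrite -sqrtrM ?(ltW D10)//.
  by congr Num.sqrt; field; rewrite !gt_eqF.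
have : Num.sqrt (b * D / D') != 0 by rewrite gt_eqF// sqrtr_gt0.
set q := Num.sqrt (b * D / D') => q0.
rewrite [in RHS]exprS invfM; set p := _ ^- n; set r := (Num.sqrt b)^-1.
by field.
Qed.

End gauss_moments.

(** * Pointwise bounds on the squared cosine *)

Section zeta_pointwise.
Context {R : realType}.

Lemma zetaE n (v a : n.-tuple R) : zeta v a = dotp v a ^+ 2 / sqn v.
Proof. by rewrite /zeta /enorm sqr_sqrtr//; exact: sqn_ge0. Qed.

Lemma zeta_ge0 n (v a : n.-tuple R) : 0 <= zeta v a.
Proof. by rewrite zetaE divr_ge0 ?sqr_ge0 ?sqn_ge0. Qed.

(** Cauchy-Schwarz: the squared length of v minus its projection on a is
nonnegative. *)
Lemma dotp_sqr_le n (v a : n.-tuple R) : sqn a = 1 -> dotp v a ^+ 2 <= sqn v.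
Proof.
move=> a1.
have : 0 <= \sum_(i < n) (tnth v i - dotp v a * tnth a i) ^+ 2.
  by apply: sumr_ge0 => i _; exact: sqr_ge0.
have -> (X : R) : \sum_(i < n) (tnth v i - X * tnth a i) ^+ 2 =
    sqn v - 2 * X * dotp v a + X ^+ 2 * sqn a.
  rewrite /sqn /dotp !mulr_sumr -sumrB -big_split/=.
  by apply: eq_bigr => i _; ring.
by rewrite a1 => h; rewrite -subr_ge0 (le_trans h)//; nra.
Qed.

Lemma zeta_le1 n (v a : n.-tuple R) : sqn a = 1 -> zeta v a <= 1.
Proof.
move=> a1; rewrite zetaE.
have [->|r0] := eqVneq (sqn v) 0; first by rewrite invr0 mulr0.
by rewrite ler_pdivrMr ?mul1r ?dotp_sqr_le// lt_def r0 sqn_ge0.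
Qed.

Lemma measurable_fun_zeta d (T : measurableType d) n (f g : T -> n.-tuple R) :
  measurable_fun setT f -> measurable_fun setT g ->
  measurable_fun setT (fun x => zeta (f x) (g x)).
Proof.
move=> mf mg.
(* The power function agrees with the inverse on [0, +oo[, including at 0. *)
have -> : (fun x => zeta (f x) (g x)) =
    (fun x => dotp (f x) (g x) ^+ 2 * powR (sqn (f x)) (-1)).
  by apply/funext => x; rewrite zetaE powR_inv1// sqn_ge0.
apply: measurable_funM.
  by apply: measurable_funX; exact: measurable_fun_dotp.
apply: (measurableT_comp (measurable_powR (-1))).
exact: measurable_fun_sqn.
Qed.

Definition gexp n (a : n.-tuple R) (c y : R) (v : n.-tuple R) : R :=
  expR (c * dotp v a ^+ 2 - y * sqn v).

(** Either r >= n/4, and then n zeta / 16 <= X^2 / 4; or r < n/4, and then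
zeta <= 1 is enough because n/16 <= 5n/16 - r. *)
Lemma expR_zeta_le n (v a : n.-tuple R) : sqn a = 1 ->
  expR (n%:R * zeta v a / 16) <=
  gexp a 4^-1 0 v + expR (5 / 16) ^+ n * gexp a 0 1 v.
Proof.
move=> a1; rewrite /gexp !mul0r subr0 mul1r sub0r -expRM_natl -expRD.
have r0 := sqn_ge0 v.
have [rn|rn] := leP (n%:R / 4) (sqn v).
  rewrite ler_wpDr ?expR_ge0// ler_expR zetaE.
  have [re|re] := eqVneq (sqn v) 0.
    by rewrite re invr0 !mulr0 mul0r mulr_ge0// sqr_ge0.
  rewrite ler_pdivrMr// mulrA ler_pdivrMr ?lt_def ?re//.
  have := ler_wpM2r (sqr_ge0 (dotp v a)) rn.
  by nra.
rewrite ler_wpDl ?expR_ge0// ler_expR.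
have := zeta_le1 v a1; have := zeta_ge0 v a.
have : 0 <= n%:R :> R by [].
by nra.
Qed.

(** Two tangent-line inequalities: e (y r) exp (- y r) <= 1 bounds 1 / r from
below, and 1 - exp (- eps X^2) <= eps X^2 bounds X^2 from below. The result is a
difference of two exponentials of quadratic forms. *)
Lemma zeta_ge_gauss n (v a : n.-tuple R) (eps y : R) : sqn a = 1 ->
  0 < eps -> 0 < y ->
  expR 1 * y / eps * (gexp a 0 y v - gexp a (- eps) y v) <= zeta v a.
Proof.
move=> a1 e0 y0.
rewrite /gexp mul0r sub0r zetaE.
have X0 := dotp_sqr_le v a1; have r0 := sqn_ge0 v.
have [re|rn0] := eqVneq (sqn v) 0.
  have -> : dotp v a ^+ 2 = 0 by apply/le_anti; rewrite sqr_ge0 -re X0.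
  by rewrite re !mulr0 sub0r subrr mulr0 mul0r.
have rp : 0 < sqn v by rewrite lt_def rn0.
rewrite ler_pdivlMr//.
move: (dotp v a ^+ 2) (sqr_ge0 (dotp v a)) X0 => X X0 Xr.
move: (sqn v) r0 rn0 rp Xr => r r0 rn0 rp Xr.
rewrite expRD.
have h1 : 1 - expR (- eps * X) <= eps * X.
  by have := expR_ge1Dx (- eps * X); lra.
have h1' : 0 <= 1 - expR (- eps * X).
  by rewrite subr_ge0 expR_le1 mulNr oppr_le0 mulr_ge0// ltW.
have h2 : expR 1 * (y * r) * expR (- (y * r)) <= 1.
  rewrite mulrAC -expRD.
  have := expR_ge1Dx (y * r - 1); rewrite addrC subrK => h.
  rewrite (_ : 1 - y * r = - (y * r - 1)); last by ring.
  by rewrite expRN mulrC ler_pdivrMr ?expR_gt0// mul1r.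
rewrite [leLHS](_ : _ = expR 1 * (y * r) * expR (- (y * r)) *
    ((1 - expR (- eps * X)) / eps)); last by field; rewrite gt_eqF.
rewrite -[leRHS]mul1r ler_pM//.
- by rewrite !mulr_ge0// ?expR_ge0// ltW.
- by rewrite divr_ge0// ltW.
- by rewrite ler_pdivrMr// [leRHS]mulrC.
Qed.

End zeta_pointwise.

Section exponential_estimates.
Context {R : realType}.

Lemma expR1_ge : 263 / 100 <= expR 1 :> R.
Proof.
have -> : 1 = 16%:R * 16^-1 :> R by rewrite divff.
rewrite expRM_natl.
apply: (@le_trans _ _ ((1 + 16^-1) ^+ 16)); first by lra.
by rewrite lerXn2r ?nnegrE ?expR_ge0 ?expR_ge1Dx//; lra.
Qed.

Lemma expR_le_inv (x : R) : x < 1 -> expR x <= (1 - x)^-1.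
Proof.
move=> x1; rewrite -[x in expR x]opprK expRN.
rewrite lef_pV2 ?posrE ?expR_gt0 ?subr_gt0//.
exact: expR_ge1Dx.
Qed.

Lemma expR1_le : expR 1 <= 27 / 8 :> R.
Proof.
have -> : 1 = 3%:R * 3^-1 :> R by rewrite divff.
rewrite expRM_natl.
apply: (@le_trans _ _ ((1 - 3^-1)^-1 ^+ 3)); last first.
  by rewrite (_ : 1 - 3^-1 = 2 / 3); lra.
by rewrite lerXn2r ?nnegrE ?expR_ge0 ?expR_le_inv ?invr_ge0//; lra.
Qed.

(** The left-hand power decreases from 27 to e^2, and the factor 32/125 is just
below e^2 / 27, so that the case d = 1 is the tight one. From d = 4 on, the
bound (1 + 2/d)^(d+2) <= exp (2 + 4/d) <= e^3 is good enough. *)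
Lemma pow_le_sqr_expR1 (d : nat) : (0 < d)%N ->
  (32 / 125) * (1 + 2 / d%:R) ^+ (d + 2) <= expR 1 ^+ 2 :> R.
Proof.
move=> d0.
have e1 := expR1_ge; have e2 := expR1_le.
have [d4|] := leqP 4 d; last first.
  case: d d0 => [//|[|[|[|//]]]] _ _ /=.
  - have -> : (1 + 2 / 1) = 3 :> R by lra.
    by rewrite /=; nra.
  - have -> : (1 + 2 / 2) = 2 :> R by lra.
    by rewrite /=; nra.
  - by rewrite /=; nra.
have dp : 0 < d%:R :> R by rewrite ltr0n.
have d4R : 4 <= d%:R :> R by rewrite ler_nat.
apply: (@le_trans _ _ ((32 / 125) * expR 1 ^+ 3)); last first.
  move: (expR 1) e1 e2 => e e1 e2.
  have : 0 <= e ^+ 2 * (1 - 32 / 125 * e) by rewrite mulr_ge0 ?sqr_ge0//; lra.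
  by rewrite [e ^+ 3]exprS; lra.
apply: ler_wpM2l; first by lra.
rewrite -expRM_natl mulr1.
apply: (@le_trans _ _ (expR (2 / d%:R) ^+ (d + 2))).
  by rewrite lerXn2r ?nnegrE ?expR_ge0 ?expR_ge1Dx// addr_ge0// divr_ge0.
rewrite -expRM_natl ler_expR natrD mulrA ler_pdivrMr//.
by lra.
Qed.

Lemma expRN_le (v : R) : 0 <= v -> expR (- v) <= 1 - v + v ^+ 2.
Proof.
move=> v0; rewrite (le_trans (expR_le_inv _))//; first by lra.
rewrite opprK -[leRHS]mulr1 -[leLHS]mul1r ler_pdivrMr; last by lra.
rewrite mulr1; have : 0 <= v ^+ 3 by exact: exprn_ge0.
by nra.
Qed.

Lemma sqr_le_expR (z : R) : 0 <= z -> z ^+ 2 <= 4 * expR z.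
Proof.
move=> z0; have h := expR_ge1Dx (z / 2).
rewrite (_ : z = 2%:R * (z / 2)); last by lra.
rewrite expRM_natl; nra.
Qed.

Lemma expR_scale_le (s z : R) : 0 <= z -> 0 <= s <= 2^-1 ->
  expR (s * z) <= 1 + 2 * s * expR z.
Proof.
move=> z0 /andP[s0 s1].
have h1 : expR (s * z) - 1 <= s * z * expR (s * z).
  have := expR_ge1Dx (- (s * z)).
  rewrite expRN => h.
  have := ler_wpM2r (expR_ge0 (s * z)) h.
  rewrite mulVf ?gt_eqF ?expR_gt0//; lra.
have h2 : expR (s * z) <= expR (z / 2) by rewrite ler_expR mulrC ler_wpM2l.
have h3 := expR_ge1Dx (z / 2).
have h4 : expR z = expR (z / 2) * expR (z / 2) by rewrite -expRD -splitr.
have h5 : z * expR (s * z) <= 2 * expR z.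
  rewrite h4; have := expR_ge0 (z / 2); have := expR_ge0 (s * z); nra.
have := ler_wpM2l s0 h5; nra.
Qed.

End exponential_estimates.

(** * Exponential moments of the squared cosine *)

Section nonneg_integrals.
Context d (T : measurableType d) {R : realType} (P : probability T R).

Lemma ge0_integralDZ (f g : T -> R) (k : R) :
  measurable_fun setT f -> measurable_fun setT g ->
  (forall x, 0 <= f x) -> (forall x, 0 <= g x) -> 0 <= k ->
  (\int[P]_x (f x + k * g x)%:E =
   \int[P]_x (f x)%:E + k%:E * \int[P]_x (g x)%:E)%E.
Proof.
move=> mf mg f0 g0 k0.
under eq_integral do rewrite EFinD EFinM.
rewrite ge0_integralD//=.
- rewrite ge0_integralZl//=.
  + exact/measurable_EFinP.
  + by move=> x _; rewrite lee_fin.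
- by move=> x _; rewrite lee_fin.
- exact/measurable_EFinP.
- by move=> x _; rewrite -EFinM lee_fin mulr_ge0.
- by apply/measurable_EFinP; exact: measurable_funM.
Qed.

Lemma ge0_le_integral_fin (f g : T -> R) :
  measurable_fun setT f -> measurable_fun setT g ->
  (forall x, 0 <= f x) -> (forall x, f x <= g x) ->
  (\int[P]_x (f x)%:E <= \int[P]_x (g x)%:E)%E.
Proof.
move=> mf mg f0 fg; apply: ge0_le_integral => //=.
- by move=> x _; rewrite lee_fin.
- exact/measurable_EFinP.
- exact/measurable_EFinP.
- by move=> x _; rewrite lee_fin.
Qed.

Lemma integral_prob_cst (k : R) : (\int[P]_x k%:E = k%:E)%E.
Proof.
by rewrite integral_cst// [X in (_ * X)%E](probability_setT P) mule1.
Qed.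

End nonneg_integrals.

Section zeta_moments.
Context {R : realType}.

Lemma measurable_gexp n (a : n.-tuple R) (c y : R) :
  measurable_fun setT (gexp a c y).
Proof.
rewrite (_ : gexp a c y = fun v => expR (c * (dotp v a + 0) ^+ 2 - y * sqn v)).
  exact: measurable_gauss_quad.
by apply/funext => v; rewrite addr0.
Qed.

Lemma integral_gexp n (a : n.-tuple R) (c y : R) : sqn a = 1 ->
  0 < 1 + 2 * y -> 0 < 1 + 2 * y - 2 * c ->
  (\int[gauss n]_v (gexp a c y v)%:E =
   (Num.sqrt (1 + 2 * y) ^- n *
    Num.sqrt ((1 + 2 * y) / (1 + 2 * y - 2 * c)))%:E)%E.
Proof.
move=> a1 b0 D0.
have := @integral_gauss_quad R n a c 0 y b0; rewrite a1 mulr1 => /(_ D0).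
rewrite expr0n mulr0 !mul0r expR0 mulr1 => <-.
by apply: eq_integral => v _; rewrite addr0.
Qed.

Lemma measurable_expR_zeta n (a : n.-tuple R) (l : R) :
  measurable_fun setT (fun v : n.-tuple R => expR (l * zeta v a)).
Proof.
apply: measurableT_comp => //; apply: measurable_funM => //.
exact: measurable_fun_zeta.
Qed.

(** A universal exponential moment of d zeta: in [expR_zeta_le] the first term
has mean sqrt 2, and the second one has mean (exp (5/16) / sqrt 3)^n <= 1. *)
Lemma zeta_exp_moment_le3 n (a : n.-tuple R) : sqn a = 1 ->
  (\int[gauss n]_v (expR (n%:R / 16 * zeta v a))%:E <= 3%:E)%E.
Proof.
move=> a1.
apply: (@le_trans _ _ (\int[gauss n]_v
    (gexp a 4^-1 0 v + expR (5 / 16) ^+ n * gexp a 0 1 v)%:E)%E).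
  apply: ge0_le_integral_fin.
  - exact: measurable_expR_zeta.
  - apply: measurable_funD; first exact: measurable_gexp.
    by apply: measurable_funM => //; exact: measurable_gexp.
  - by move=> v; exact: expR_ge0.
  - by move=> v; rewrite mulrAC; exact: expR_zeta_le.
rewrite ge0_integralDZ; last 5 first.
- exact: measurable_gexp.
- exact: measurable_gexp.
- by move=> v; exact: expR_ge0.
- by move=> v; exact: expR_ge0.
- by rewrite exprn_ge0// expR_ge0.
rewrite !integral_gexp//; [|lra..].
rewrite -EFinM -EFinD lee_fin mulr0 addr0 sqrtr1 expr1n invr1 mul1r.
rewrite subr0 divff ?sqrtr1 ?mulr1; last by lra.
have e1 : expR (5 / 16) <= Num.sqrt (1 + 2 * 1) :> R.
  apply: (le_trans (expR_le_inv _)); first by lra.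
  rewrite -[leLHS]ger0_norm; last by rewrite invr_ge0; lra.
  rewrite -sqrtr_sqr ler_sqrt; last by lra.
  rewrite (_ : (1 - 5 / 16)^-1 = 16 / 11 :> R); [lra|by field].
have h1 : expR (5 / 16) ^+ n * Num.sqrt (1 + 2 * 1) ^- n <= 1 :> R.
  have s0 : 0 < Num.sqrt (1 + 2 * 1) :> R by rewrite sqrtr_gt0; lra.
  rewrite -exprVn -exprMn exprn_ile1 ?mulr_ge0 ?expR_ge0 ?invr_ge0 ?(ltW s0)//.
  by rewrite ler_pdivrMr// mul1r.
have h2 : Num.sqrt (1 / (1 - 2 * 4^-1)) <= 2 :> R.
  rewrite -[leRHS]ger0_norm// -sqrtr_sqr ler_sqrt; last by lra.
  rewrite (_ : 1 - 2 / 4 = 2^-1 :> R); lra.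
rewrite mulr1 in h1 h2 *; lra.
Qed.

(** The lower comparison of [zeta_ge_gauss] with y = 1/n has a mean that exceeds
1/(2n) by a fixed relative margin eps, uniformly in n. After
1 - sqrt x >= (1 - x) / 2 this is the numerical fact [pow_le_sqr_expR1]. *)
Lemma zeta_mean_constant n (b eps : R) : (0 < n)%N -> b = 1 + 2 / n%:R ->
  0 < eps -> ((1 + eps) / 2) ^+ 2 * (1 + 2 * eps) ^+ 2 <= 32 / 125 ->
  (1 + eps) / 2 <= expR 1 / eps *
    (Num.sqrt b ^- n - Num.sqrt b ^- n * Num.sqrt (b / (b + 2 * eps))).
Proof.
move=> n0 bE e0 epsP.
have b1 : 1 <= b by rewrite bE lerDl divr_ge0.
have b0 : 0 < b by exact: lt_le_trans b1.
have be0 : 0 < b + 2 * eps by rewrite addr_gt0// mulr_gt0.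
have h1 : eps / (b + 2 * eps) <= 1 - Num.sqrt (b / (b + 2 * eps)).
  have /sqr_sqrtr : 0 <= b / (b + 2 * eps) by rewrite divr_ge0// ltW.
  set s := Num.sqrt _ => sE.
  have -> : eps / (b + 2 * eps) = (1 - s ^+ 2) / 2.
    by rewrite sE; field; rewrite gt_eqF.
  by have := sqr_ge0 (s - 1); rewrite sqrrB; lra.
rewrite -[X in X - _]mulr1 -mulrBr.
set N := Num.sqrt b ^- n.
have sb0 : 0 < Num.sqrt b ^+ n by rewrite exprn_gt0// sqrtr_gt0.
apply: (@le_trans _ _ (expR 1 / eps * (N * (eps / (b + 2 * eps))))); last first.
  apply: ler_wpM2l; first by apply: divr_ge0; [exact: expR_ge0|exact: ltW].
  by apply: ler_wpM2l => //; rewrite invr_ge0 ltW.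
have -> : expR 1 / eps * (N * (eps / (b + 2 * eps))) =
    expR 1 / (Num.sqrt b ^+ n * (b + 2 * eps)).
  by rewrite /N; field; rewrite !gt_eqF.
rewrite ler_pdivlMr; last exact: mulr_gt0.
have e1 : 0 <= (1 + eps) / 2 by rewrite divr_ge0// addr_ge0// ltW.
rewrite -ler_sqr ?nnegrE ?expR_ge0//; last first.
  by rewrite mulr_ge0// mulr_ge0// ltW.
apply: (le_trans _ (pow_le_sqr_expR1 n0)).
rewrite -bE !exprMn -exprM mulnC exprM sqr_sqrtr; last exact: ltW.
rewrite exprD mulrCA [leRHS]mulrCA ler_wpM2l//.
  by rewrite exprn_ge0// ltW.
apply: (@le_trans _ _ (((1 + eps) / 2) ^+ 2 * (1 + 2 * eps) ^+ 2 * b ^+ 2)).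
  rewrite -exprMn -mulrA -!exprMn.
  rewrite ler_sqr ?nnegrE ?mulr_ge0 ?addr_ge0 ?mulr_ge0 ?(ltW b0) ?(ltW e0)//.
  apply: ler_wpM2l => //.
  rewrite -subr_ge0 (_ : _ - _ = 2 * eps * (b - 1)); last by ring.
  by rewrite mulr_ge0 ?subr_ge0// mulr_ge0// ltW.
by rewrite ler_wpM2r// sqr_ge0.
Qed.

(** Second-order expansion: exp (- v) <= 1 - v + v^2 with v = x n zeta. The mean
of v is at least x (1 + eps) / 2, the mean of v^2 is O(x^2) by
[zeta_exp_moment_le3], and for x small against eps the surplus x eps / 2 absorbs
the quadratic term. *)
Lemma zeta_lower_mgf n (a : n.-tuple R) (x eps : R) :
  (0 < n)%N -> sqn a = 1 ->
  0 < eps -> ((1 + eps) / 2) ^+ 2 * (1 + 2 * eps) ^+ 2 <= 32 / 125 ->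
  0 <= x -> 6 * 32 ^+ 2 * x <= eps ->
  (\int[gauss n]_v (expR (x * (2^-1 - n%:R * zeta v a)))%:E <= 1)%E.
Proof.
move=> n0 a1 e0 epsP x0 xe.
pose y := n%:R^-1 : R.
have y0 : 0 < y by rewrite invr_gt0 ltr0n.
pose b := 1 + 2 * y.
have b0 : 0 < b by rewrite addr_gt0// mulr_gt0.
have be0 : 0 < b + 2 * eps by rewrite addr_gt0// mulr_gt0.
pose A0 := gexp a 0 y.
pose A1 := gexp a (- eps) y.
pose Z (v : n.-tuple R) := expR (n%:R / 16 * zeta v a).
pose F (v : n.-tuple R) := expR (- (x * n%:R) * zeta v a).
pose k := x * (expR 1 / eps).
pose l := (32 * x) ^+ 2.
have k0 : 0 <= k by rewrite mulr_ge0// divr_ge0 ?expR_ge0// ltW.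
have l0 : 0 <= l by exact: sqr_ge0.
have mA0 : measurable_fun setT A0 by exact: measurable_gexp.
have mA1 : measurable_fun setT A1 by exact: measurable_gexp.
have mZ : measurable_fun setT Z by exact: measurable_expR_zeta.
have mF : measurable_fun setT F by exact: measurable_expR_zeta.
have A00 v : 0 <= A0 v by exact: expR_ge0.
have A10 v : 0 <= A1 v by exact: expR_ge0.
have Z0 v : 0 <= Z v by exact: expR_ge0.
have F0 v : 0 <= F v by exact: expR_ge0.
(* The subtracted exponential A0 is moved to the left so that only nonnegative
   functions are integrated. *)
have main v : F v + k * A0 v <= (1 + k * A1 v) + l * Z v.
  have h1 := zeta_ge_gauss v a1 e0 y0.
  have nz0 : 0 <= n%:R * zeta v a by rewrite mulr_ge0// zeta_ge0.
  have h2 := expRN_le (mulr_ge0 x0 nz0).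
  have h3 := sqr_le_expR (divr_ge0 nz0 (ler0n R 16)).
  rewrite (_ : F v = expR (- (x * (n%:R * zeta v a)))); last first.
    by congr expR; ring.
  rewrite (_ : Z v = expR (n%:R * zeta v a / 16)); last first.
    by congr expR; ring.
  have h4 := ler_wpM2l (sqr_ge0 (16 * x)) h3.
  have h5 : k * (A0 v - A1 v) <= x * (n%:R * zeta v a).
    have := ler_wpM2l (mulr_ge0 x0 (ler0n R n)) h1.
    rewrite -/A0 -/A1 -[X in _ <= X]mulrA; apply: le_trans.
    rewrite le_eqVlt; apply/orP; left; apply/eqP.
    by rewrite /k /y; field; rewrite gt_eqF//= pnatr_eq0 -lt0n n0.
  move: h2 h4 h5; rewrite /l; move: (zeta v a) (A0 v) (A1 v) (expR _) (expR _).
  by move=> z a0' a1' E1 E2; lra.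
pose a0 := Num.sqrt b ^- n.
pose b1 := Num.sqrt b ^- n * Num.sqrt (b / (b + 2 * eps)).
have IA0 : (\int[gauss n]_v (A0 v)%:E = a0%:E)%E.
  rewrite integral_gexp//; last by rewrite mulr0 subr0.
  by rewrite mulr0 subr0 divff ?sqrtr1 ?mulr1// gt_eqF.
have IA1 : (\int[gauss n]_v (A1 v)%:E = b1%:E)%E.
  by rewrite integral_gexp// mulrN opprK.
have : (\int[gauss n]_v (F v)%:E + (k * a0)%:E <= (1 + k * b1 + l * 3)%:E)%E.
  apply: (@le_trans _ _ (\int[gauss n]_v ((1 + k * A1 v) + l * Z v)%:E)%E).
    rewrite EFinM -IA0 -ge0_integralDZ//.
    apply: ge0_le_integral_fin => //.
    - by apply: measurable_funD => //; exact: measurable_funM.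
    - apply: measurable_funD; last exact: measurable_funM.
      by apply: measurable_funD => //; exact: measurable_funM.
    - by move=> v; rewrite addr_ge0// mulr_ge0.
  rewrite ge0_integralDZ//; last 2 first.
  - by apply: measurable_funD => //; exact: measurable_funM.
  - by move=> v; rewrite addr_ge0// mulr_ge0.
  rewrite ge0_integralDZ// integral_prob_cst IA1 !EFinD !EFinM.
  by rewrite leeD2l// lee_wpmul2l ?lee_fin// zeta_exp_moment_le3.
have : (0 <= \int[gauss n]_v (F v)%:E)%E.
  by apply: integral_ge0 => v _; rewrite lee_fin.
case IF : (\int[gauss n]_v (F v)%:E)%E => [r| |]// _.
rewrite -EFinD lee_fin => rle.
have r1 : r <= 1 - x / 2.
  have := ler_wpM2l x0 (zeta_mean_constant n0 (erefl b) e0 epsP).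
  rewrite -/a0 -/b1 [leRHS]mulrA -/k => h1.
  have h2 : l * 3 <= x * (eps / 2).
    rewrite (_ : l * 3 = x * (6 * 32 ^+ 2 * x / 2)); last by rewrite /l; field.
    by rewrite ler_wpM2l// ler_pM2r.
  lra.
rewrite (_ : (fun v => _) = (fun v => (0 + expR (x / 2) * F v)%:E)); last first.
  by apply/funext => v; rewrite add0r -expRD; congr ((expR _)%:E); field.
rewrite ge0_integralDZ ?expR_ge0// integral_prob_cst IF -EFinM add0e lee_fin.
apply: (@le_trans _ _ (expR (x / 2) * expR (- (x / 2)))); last first.
  by rewrite expRxMexpNx_1.
rewrite ler_wpM2l ?expR_ge0// (le_trans r1)//.
exact: expR_ge1Dx.
Qed.

(** By [expR_scale_le], exp (x n zeta) <= 1 + 32 x exp (n zeta / 16), whose mean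
is at most 1 + 32 * 3 x; this is where the constant 96 comes from. *)
Lemma zeta_upper_mgf n (a : n.-tuple R) (x : R) : sqn a = 1 ->
  0 <= x <= 32^-1 ->
  (\int[gauss n]_v (expR (x * (n%:R * zeta v a - 96)))%:E <= 1)%E.
Proof.
move=> a1 /andP[x0 x1].
pose Z (v : n.-tuple R) := expR (n%:R / 16 * zeta v a).
apply: (@le_trans _ _ (\int[gauss n]_v
    (expR (- (96 * x)) + (expR (- (96 * x)) * (32 * x)) * Z v)%:E)%E).
  apply: ge0_le_integral_fin.
  - apply: measurableT_comp => //; apply: measurable_funM => //.
    apply: measurable_funB => //; apply: measurable_funM => //.
    exact: measurable_fun_zeta.
  - apply: measurable_funD => //; apply: measurable_funM => //.
    exact: measurable_expR_zeta.
  - by move=> v; exact: expR_ge0.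
  - move=> v.
    rewrite (_ : x * _ = - (96 * x) + (16 * x) * (n%:R / 16 * zeta v a));
      last by field.
    rewrite expRD /Z; set z := _ * zeta v a.
    have z0 : 0 <= z by rewrite /z mulr_ge0 ?zeta_ge0// divr_ge0.
    have x16 : 0 <= 16 * x <= 2^-1 by apply/andP; split; lra.
    have := ler_wpM2l (expR_ge0 (- (96 * x))) (expR_scale_le z0 x16).
    by move=> h; rewrite (le_trans h)//; lra.
rewrite ge0_integralDZ; last 5 first.
- exact: measurable_cst.
- exact: measurable_expR_zeta.
- by move=> v; exact: expR_ge0.
- by move=> v; exact: expR_ge0.
- by rewrite mulr_ge0 ?expR_ge0// mulr_ge0.
rewrite integral_prob_cst.
apply: (@le_trans _ _ ((expR (- (96 * x)))%:E +
    (expR (- (96 * x)) * (32 * x))%:E * 3%:E)%E).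
  rewrite leeD2l// lee_wpmul2l ?zeta_exp_moment_le3// lee_fin.
  by rewrite mulr_ge0 ?expR_ge0// mulr_ge0.
rewrite -EFinM -EFinD lee_fin.
rewrite (_ : _ + _ = expR (- (96 * x)) * (1 + 96 * x)); last by ring.
by rewrite expRN mulrC ler_pdivrMr ?expR_gt0// mul1r expR_ge1Dx.
Qed.

End zeta_moments.

(** * Conditioning on the past and the maximal inequality *)

Section freezing.
Context {R : realType} {d : measure_display} {Omega : measurableType d}.
Variables (P : probability Omega R) (G : set (set Omega)).
Hypotheses (sG : sigma_algebra setT G) (GM : G `<=` measurable).
Context {d' : measure_display} {V : measurableType d'}.

Lemma adapted_toP (X : Omega -> V) :
  adapted_to G X <-> measurable_fun setT (X : g_sigma_algebraType G -> V).
Proof.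
split=> [aX _ B mB|mX B mB].
  by rewrite setTI; apply: sub_sigma_algebra; exact: aX.
have := mX measurableT B mB; rewrite setTI.
by rewrite /measurable/= sigma_algebra_id.
Qed.

Lemma adapted_to_measurable (X : Omega -> V) :
  adapted_to G X -> measurable_fun setT X.
Proof. by move=> aX _ B mB; rewrite setTI; apply: GM; exact: aX. Qed.

Variables (Q : probability V R) (X : Omega -> V).
Hypotheses (mX : measurable_fun setT X) (XQ : has_law P X Q).
Hypothesis (indX : independent_of P G X).

Let OG := g_sigma_algebraType G.

(* The identity, seen as a measurable map onto the coarser space. *)
Let past (om : Omega) : OG := om.

Let measurable_past : measurable_fun setT past.
Proof.
move=> _ B mB; rewrite setTI; apply: GM.
by move: mB; rewrite /measurable/= sigma_algebra_id.
Qed.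

Let past_mixin := isMeasurableFun.Build _ _ _ _ _ measurable_past.
Let past_mfun : {mfun _ >-> _} := HB.pack past past_mixin.

Let joint (om : Omega) : OG * V := (past om, X om).

Let measurable_joint : measurable_fun setT joint.
Proof. exact: measurable_fun_pair. Qed.

Let joint_mixin := isMeasurableFun.Build _ _ _ _ _ measurable_joint.
Let joint_mfun : {mfun _ >-> _} := HB.pack joint joint_mixin.

(** Independence says that the joint law of the past and of X agrees with a
product measure on rectangles, hence everywhere. *)
Lemma integral_freeze (f : g_sigma_algebraType G * V -> \bar R) :
  measurable_fun setT f -> (forall x, (0 <= f x)%E) ->
  (\int[P]_om f (om, X om) = \int[P]_om \int[Q]_v f (om, v))%E.
Proof.
move=> mf f0.
have jointE (A : set (OG * V)) : measurable A ->
    (distribution P past_mfun \x Q)%E A = distribution P joint_mfun A.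
  apply: product_measure_unique => B C mB mC.
  rewrite /distribution /pushforward /= -XQ//.
  rewrite -indX//; move: mB; by rewrite /measurable/= sigma_algebra_id.
transitivity (\int[distribution P joint_mfun]_x f x)%E.
  by rewrite ge0_integral_distribution.
rewrite (eq_measure_integral (distribution P past_mfun \x Q)%E); last first.
  by move=> A mA _; exact/esym/jointE.
rewrite fubini_tonelli1// ge0_integral_distribution//.
- exact: measurable_fun_fubini_tonelli_F.
- by move=> x; apply: integral_ge0 => v _; exact: f0.
Qed.

End freezing.

Section supermartingale.
Context {R : realType} {d : measure_display} {Omega : measurableType d}.
Variables (P : probability Omega R) (F : nat -> set (set Omega)).
Hypothesis filtrF : filtration F.
Variables (X : nat -> Omega -> R) (N : nat).
Hypothesis X0 : forall t om, 0 <= X t om.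
Hypothesis aX : forall t, (t < N)%N -> adapted_to (F t.+1) (X t).
(* The conditional expectation of X t given F t is at most 1, tested against
   nonnegative F t-measurable functions. *)
Hypothesis superX : forall t, (t < N)%N -> forall g : Omega -> R,
  adapted_to (F t) g -> (forall om, 0 <= g om) ->
  (\int[P]_om (g om * X t om)%:E <= \int[P]_om (g om)%:E)%E.

(** The product of the X t, frozen as soon as it reaches the level x. Its final
value remembers whether the level was ever reached, so that Markov's inequality
at the last time is already a maximal inequality. *)
Fixpoint stopped (x : R) (n : nat) (om : Omega) : R :=
  if n is m.+1 then
    stopped x m om * (if x <= stopped x m om then 1 else X m om)
  else 1.

Let prodX n om := \prod_(0 <= t < n) X t om.

Lemma stopped_ge0 x n om : 0 <= stopped x n om.
Proof. by elim: n => //= n IH; rewrite mulr_ge0//; case: ifP. Qed.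

Lemma stopped_cases x n om :
  x <= stopped x n om \/
  (stopped x n om = prodX n om /\ forall m, (m <= n)%N -> prodX m om < x).
Proof.
rewrite /prodX; elim: n => [|n [IH|[IH1 IH2]]] /=.
- rewrite big_nil; have [x1|x1] := leP x 1; [by left|right].
  by split => // m; rewrite leqn0 => /eqP->; rewrite big_nil.
- by left; rewrite IH mulr1.
- have [x1|x1] := leP x (stopped x n om); first by left; rewrite mulr1.
  rewrite IH1 -big_nat_recr//=.
  have [x2|x2] := leP x (\prod_(0 <= t < n.+1) X t om); [by left|right].
  split => // m; rewrite leq_eqVlt => /orP[/eqP->//|]; rewrite ltnS.
  exact: IH2.
Qed.

Lemma stopped_adapted x n : (n <= N)%N -> adapted_to (F n) (stopped x n).
Proof.
have [sF mF incF] := filtrF.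
elim: n => [|n IH] nN; apply/(adapted_toP (sF _)).
  exact: measurable_cst.
have mS : measurable_fun setT (stopped x n : g_sigma_algebraType (F n.+1) -> R).
  apply/adapted_toP => // B mB; apply: (incF n) => //.
  exact: IH (ltnW nN) _ mB.
apply: measurable_funM => //; apply: measurable_fun_ifT => //.
- exact: measurable_fun_ler.
- exact/adapted_toP/aX.
Qed.

(** Only the part of the process that is not yet stopped is multiplied by X n,
and whether it is stopped is known at time n. *)
Lemma stopped_mean_le1 x n : (n <= N)%N ->
  (\int[P]_om (stopped x n om)%:E <= 1)%E.
Proof.
have [sF mF incF] := filtrF.
elim: n => [|n IH] nN; first by rewrite integral_prob_cst.
apply: le_trans (IH (ltnW nN)).
pose B om := x <= stopped x n om.
pose g1 om := stopped x n om * (if B om then 1 else 0).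
pose g2 om := stopped x n om * (if B om then 0 else 1).
have mS := (adapted_toP (sF n) _).1 (stopped_adapted x (ltnW nN)).
have mB : measurable_fun setT (B : g_sigma_algebraType (F n) -> bool).
  exact: measurable_fun_ler.
have ag1 : adapted_to (F n) g1.
  apply/(adapted_toP (sF n)); apply: measurable_funM => //.
  exact: measurable_fun_ifT.
have ag2 : adapted_to (F n) g2.
  apply/(adapted_toP (sF n)); apply: measurable_funM => //.
  exact: measurable_fun_ifT.
have g10 om : 0 <= g1 om by rewrite mulr_ge0 ?stopped_ge0//; case: ifP.
have g20 om : 0 <= g2 om by rewrite mulr_ge0 ?stopped_ge0//; case: ifP.
have m1 := adapted_to_measurable (mF n) ag1.
have m2 := adapted_to_measurable (mF n) ag2.
have mX := adapted_to_measurable (mF n.+1) (aX nN).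
rewrite (_ : (fun om => _) =
    (fun om => (g1 om + 1 * (g2 om * X n om))%:E)); last first.
  apply/funext => om /=; congr EFin; rewrite /g1 /g2 /B.
  by case: ifP => _; ring.
rewrite [leRHS](_ : _ = \int[P]_om (g1 om + 1 * g2 om)%:E)%E; last first.
  apply: eq_integral => om _; congr EFin; rewrite /g1 /g2.
  by case: ifP => _; ring.
rewrite !ge0_integralDZ//; last 2 first.
- exact: measurable_funM.
- by move=> om; rewrite mulr_ge0.
by rewrite leeD2l// !mul1e; exact: superX.
Qed.

(** Markov's inequality for the stopped process. *)
Lemma ville_inequality x : 0 < x -> exists E : set Omega,
  [/\ measurable E, (P E <= (x^-1)%:E)%E &
   forall om, ~ E om -> forall n, (n <= N)%N -> \prod_(0 <= t < n) X t om < x].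
Proof.
have [sF mF incF] := filtrF.
move=> x0; pose E := [set om | x <= stopped x N om].
have mS := adapted_to_measurable (mF N) (stopped_adapted x (leqnn N)).
have mE : measurable E.
  rewrite -[E]setTI; apply: measurable_fun_le => //; exact: measurable_cst.
exists E; split => //.
- rewrite -[(x^-1)%:E]mule1 -lee_pdivrMl ?invr_gt0// invrK.
  apply: le_trans (stopped_mean_le1 x (leqnn N)).
  have mS' : measurable_fun setT (EFin \o stopped x N).
    exact/measurable_EFinP.
  have := le_integral_abse P measurableT mS' x0.
  rewrite setTI (_ : [set om | _] = E); last first.
    apply/seteqP; split => om /=; rewrite lee_fin ger0_norm ?stopped_ge0//.
  move=> /le_trans; apply; rewrite le_eqVlt; apply/orP; left; apply/eqP.
  by apply: eq_integral => om _ /=; rewrite ger0_norm ?stopped_ge0.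
- move=> om nE; have [//|[_ h]] := stopped_cases x N om.
  exact: h.
Qed.

End supermartingale.

(** * The squared cosines along the sampled path *)

Section zeta_process.
Context {R : realType} {disp : measure_display} {Omega : measurableType disp}.
Variables (P : probability Omega R) (d : nat).

Lemma enorm_eq1 (b : d.-tuple R) : enorm b = 1 -> sqn b = 1.
Proof.
by move=> b1; rewrite -[LHS]sqr_sqrtr ?sqn_ge0// -/(enorm b) b1 expr1n.
Qed.

(** Supermartingale step: freezing the past at om leaves a Gaussian integral
against the unit vector a om, which the hypothesis on h bounds by 1. *)
Lemma zeta_step (G : set (set Omega)) (a u : Omega -> d.-tuple R)
    (g : Omega -> R) (h : R -> R) :
  sigma_algebra setT G -> G `<=` measurable ->
  adapted_to G a -> (forall om, enorm (a om) = 1) ->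
  measurable_fun setT u -> has_law P u (@std_gaussian R d) ->
  independent_of P G u ->
  adapted_to G g -> (forall om, 0 <= g om) ->
  measurable_fun setT h -> (forall z, 0 <= h z) ->
  (forall b : d.-tuple R, sqn b = 1 ->
    (\int[gauss d]_v (h (zeta v b))%:E <= 1)%E) ->
  (\int[P]_om (g om * h (zeta (u om) (a om)))%:E <= \int[P]_om (g om)%:E)%E.
Proof.
move=> sG GM aa a1 mu lawu indu ag g0 mh h0 hle.
have lawg : has_law P u (gauss d).
  by move=> B mB; rewrite lawu// std_gaussianE.
pose f (x : g_sigma_algebraType G * d.-tuple R) :=
  (g x.1 * h (zeta x.2 (a x.1)))%:E.
have mf : measurable_fun setT f.
  apply/measurable_EFinP; apply: measurable_funM.
    by apply: measurableT_comp => //; exact/adapted_toP.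
  apply: measurableT_comp => //; apply: measurable_fun_zeta => //.
  by apply: measurableT_comp => //; exact/adapted_toP.
have f0 x : (0 <= f x)%E by rewrite lee_fin mulr_ge0.
have -> : (\int[P]_om (g om * h (zeta (u om) (a om)))%:E =
    \int[P]_om \int[gauss d]_v f (om, v))%E.
  by rewrite -(integral_freeze sG GM mu lawg indu mf f0).
apply: ge0_le_integral => //.
- by move=> om _; apply: integral_ge0.
- apply: (adapted_to_measurable GM); apply/(adapted_toP sG).
  exact: (measurable_fun_fubini_tonelli_F _ mf f0).
- apply/measurable_EFinP; exact: (adapted_to_measurable GM ag).
- move=> om _; rewrite /f/=.
  under eq_integral do rewrite EFinM.
  rewrite ge0_integralZl//=.
  + by rewrite -[leRHS]mule1 lee_wpmul2l ?lee_fin// hle// enorm_eq1.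
  + apply/measurable_EFinP; apply: measurableT_comp => //.
    exact: measurable_fun_zeta.
  + by move=> v _; rewrite lee_fin.
  + by rewrite lee_fin.
Qed.

Lemma zeta_maximal (F : nat -> set (set Omega))
    (a u : nat -> Omega -> d.-tuple R) (T : nat) (h : nat -> R -> R) (x : R) :
  filtration F ->
  (forall t, (t < T)%N ->
     [/\ adapted_to (F t) (a t),
         forall om, enorm (a t om) = 1,
         adapted_to (F t.+1) (u t),
         has_law P (u t) (@std_gaussian R d) &
         independent_of P (F t) (u t)]) ->
  (forall t, measurable_fun setT (h t)) -> (forall t z, 0 <= h t z) ->
  (forall t (b : d.-tuple R), (t < T)%N -> sqn b = 1 ->
    (\int[gauss d]_v (h t (zeta v b))%:E <= 1)%E) ->
  0 < x ->
  exists E : set Omega,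
  [/\ measurable E, (P E <= (x^-1)%:E)%E &
   forall om, ~ E om -> forall n, (n <= T)%N ->
     \prod_(0 <= t < n) h t (zeta (u t om) (a t om)) < x].
Proof.
move=> filtF model mh h0 hle x0.
have [sF mF incF] := filtF.
apply: (ville_inequality (X := fun t om => h t (zeta (u t om) (a t om)))
  filtF) => //.
- move=> t tT; have [aa a1 au _ _] := model t tT.
  apply/(adapted_toP (sF _)); apply: measurableT_comp => //.
  apply: measurable_fun_zeta; first exact/adapted_toP.
  by apply/adapted_toP => // B mB; apply: (incF t) => //; exact: aa.
- move=> t tT g ag g0; have [aa a1 au lawu indu] := model t tT.
  apply: (zeta_step (sF t) (mF t)) => //.
  + exact: (adapted_to_measurable (mF t.+1) au).
  + by move=> b b1; exact: hle.
Qed.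

End zeta_process.

(** * Step sizes, logarithms and confidence levels *)

Section step_sizes.
Context {R : realType}.
Variable T0 : R.
Hypothesis T0_ge1 : 1 <= T0.

Let T0_gt0 : 0 < T0. Proof. exact: lt_le_trans T0_ge1. Qed.

Let nT0_gt0 (t : nat) : 0 < t%:R + T0.
Proof. by rewrite ltr_wpDl. Qed.

Lemma w_gt0 t : 0 < w T0 t.
Proof. by rewrite invr_gt0. Qed.

Lemma w_nonincreasing (i t : nat) : (i <= t)%N -> w T0 t <= w T0 i.
Proof. by move=> it; rewrite lef_pV2 ?posrE// lerD2r ler_nat. Qed.

(** Comparison with the integral of 1 / (t + T0); the first term is treated
apart because its integral would start at T0 - 1, which may vanish. *)
Lemma sum_w_le (K T : nat) : (K <= T)%N ->
  \sum_(0 <= t < K) w T0 t <= 1 + ln (T%:R + T0).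
Proof.
case: K => [_|K KT].
  by rewrite big_nil addr_ge0// ln_ge0// (le_trans T0_ge1)// lerDr.
apply: (@le_trans _ _ (1 + ln (K%:R + T0))); last first.
  by rewrite lerD2l ler_ln ?posrE// lerD2r ler_nat ltnW.
elim: K {KT} => [|K IH].
  rewrite big_nat1 /w add0r -[leLHS]addr0 lerD ?ln_ge0//.
  by rewrite invf_le1.
rewrite big_nat_recr//= (le_trans (lerD IH (lexx _)))//.
rewrite -addrA lerD2l -lerBrDl -ln_div ?posrE//.
have -> : w T0 K.+1 = - (- w T0 K.+1) by rewrite opprK.
rewrite -[X in ln X]invrK lnV ?posrE ?invr_gt0 ?divr_gt0// lerN2 invf_div.
have -> : (K%:R + T0) / (K.+1%:R + T0) = 1 + - w T0 K.+1.
  have := nT0_gt0 K.+1; rewrite /w -natr1 => h.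
  by field; rewrite gt_eqF.
apply: le_ln1Dx; rewrite ltrN2 /w invf_lt1// -natr1.
by rewrite -addrA ltr_wpDl// ltr_pwDr// ltr01.
Qed.

(** Writing i + 2 = (e + T0) s, the inequality ln s <= s gives
ln (i + 2) <= ln (e + T0) + (i + 2) / (e + T0), and T0 / (e + T0) <= 1. *)
Lemma start_penalty (i : nat) :
  T0 * ln (i.+2)%:R <= (i%:R + T0) * (ln (expR 1 + T0) + 2).
Proof.
have eT0 : 0 < expR 1 + T0 by rewrite addr_gt0// expR_gt0.
have i2 : 0 < i.+2%:R :> R by [].
have L0 : 0 <= ln (expR 1 + T0).
  by rewrite ln_ge0// (le_trans T0_ge1)// lerDr expR_ge0.
have h1 : ln i.+2%:R <= ln (expR 1 + T0) + i.+2%:R / (expR 1 + T0).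
  rewrite -lerBlDl -ln_div ?posrE// ltW// ln_sublinear// divr_gt0//.
have h2 : T0 * (i.+2%:R / (expR 1 + T0)) <= i.+2%:R.
  rewrite mulrA ler_pdivrMr// mulrC ler_wpM2l// lerDr expR_ge0//.
have h3 : i.+2%:R = i%:R + 2 :> R by rewrite -addn2 natrD.
have h4 := ler_wpM2l (ltW T0_gt0) h1.
have h5 : 0 <= i%:R * ln (expR 1 + T0) by rewrite mulr_ge0.
have : 0 <= i%:R :> R by [].
have := T0_ge1; move: h2 h4 h5; rewrite h3.
move: (_ / _) (ln _) (ln _) => q L l; lra.
Qed.

Lemma Gamma_ge (T : nat) (delta : R) : (1 <= T)%N ->
  1 + ln (1 / delta) + ln (expR 1 + T0) <= Gamma_scan T T0 delta.
Proof.
move=> T1.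
rewrite /Gamma_scan lerD2r lerDl ln_ge0// /J lerDl ler0z.
have h : 0 <= log2 (T%:R * (T%:R + T0) / T0).
  rewrite /log2 divr_ge0 ?ln_ge0 ?ler1n//.
  rewrite ler_pdivlMr// mul1r -[leLHS]mul1r ler_pM// ?ler1n//; first exact: ltW.
  by rewrite lerDr.
by rewrite Num.Theory.ceil_ge0 (lt_le_trans _ h)// ltrN10.
Qed.

End step_sizes.

Section products_and_unions.
Context {R : realType}.

Lemma prod_expR_from (f : nat -> R) (i n : nat) : (i <= n)%N ->
  \prod_(0 <= t < n) (if (t < i)%N then 1 else expR (f t)) =
  expR (\sum_(i <= t < n) f t).
Proof.
move=> iN; rewrite (big_cat_nat _ iN)//= big_nat big1 ?mul1r; last first.
  by move=> t /andP[_ ->].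
rewrite expR_sum big_nat [RHS]big_nat; apply: eq_bigr => t /andP[it _].
by rewrite ltnNge it.
Qed.

Lemma sum_filter_from (f : nat -> R) (i n : nat) :
  \sum_(0 <= t < n | i%:Z <= t%:Z) f t = \sum_(i <= t < n) f t.
Proof. by rewrite [RHS](big_nat_widenl _ _ _ _ _ (leq0n i)). Qed.

Lemma telescope_le1 (T : nat) :
  \sum_(0 <= i < T) (i.+1%:R * i.+2%:R)^-1 <= 1 :> R.
Proof.
suff -> : \sum_(0 <= i < T) (i.+1%:R * i.+2%:R)^-1 = 1 - T.+1%:R^-1 :> R.
  by rewrite gerBl invr_ge0.
elim: T => [|T IH]; first by rewrite big_nil invr1 subrr.
rewrite big_nat_recr//= IH.
have h1 : T.+1%:R != 0 :> R by rewrite pnatr_eq0.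
have h2 : T.+2%:R != 0 :> R by rewrite pnatr_eq0.
have h3 : T.+2%:R = T.+1%:R + 1 :> R by rewrite natr1.
rewrite h3 in h2 *.
by field; apply/andP.
Qed.

End products_and_unions.

(** * The good event *)

Section lower_scale.
Variable R : realType.

(** The relative margin eps in [zeta_lower_mgf]: any positive value subject to
[slack_small] would do. *)
Definition slack : R := 16^-1 ^+ 2.

Definition lower_scale : R := slack / (6 * 32 ^+ 2).

Lemma slack_gt0 : 0 < slack.
Proof. by rewrite exprn_gt0// invr_gt0. Qed.

Lemma lower_scale_gt0 : 0 < lower_scale.
Proof. by rewrite divr_gt0 ?slack_gt0// mulr_gt0// exprn_gt0. Qed.

Lemma slack_small : ((1 + slack) / 2) ^+ 2 * (1 + 2 * slack) ^+ 2 <= 32 / 125.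
Proof. by rewrite /slack; lra. Qed.

Lemma zeta_lower_mgf_scale n (a : n.-tuple R) (x : R) :
  (0 < n)%N -> sqn a = 1 -> 0 <= x <= lower_scale ->
  (\int[gauss n]_v (expR (x * (2^-1 - n%:R * zeta v a)))%:E <= 1)%E.
Proof.
move=> n0 a1 /andP[x0 xs]; apply: (zeta_lower_mgf n0 a1 slack_gt0) => //.
  exact: slack_small.
by rewrite mulrC -ler_pdivlMr// mulr_gt0// exprn_gt0.
Qed.

End lower_scale.

Section good_events.
Context {R : realType} {disp : measure_display} {Omega : measurableType disp}.
Variables (P : probability Omega R) (F : nat -> set (set Omega)).
Variables (T d : nat) (T0 : R) (a u : nat -> Omega -> d.-tuple R).
Hypotheses (d_gt0 : (0 < d)%N) (T0_ge1 : 1 <= T0) (filtF : filtration F).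
Hypothesis model : forall t, (t < T)%N ->
  [/\ adapted_to (F t) (a t),
      forall om, enorm (a t om) = 1,
      adapted_to (F t.+1) (u t),
      has_law P (u t) (@std_gaussian R d) &
      independent_of P (F t) (u t)].

Let z t om := zeta (u t om) (a t om).

(** The exponents x = lower_scale * w_t / w_i never exceed lower_scale since w
decreases; before time i the factors are 1, so that the process starts at i. *)
Lemma lower_tail_event (i : nat) (p : R) : 0 < p -> exists E : set Omega,
  [/\ measurable E, (P E <= p%:E)%E &
   forall om, ~ E om -> forall n, (i <= n <= T)%N ->
     \sum_(i <= t < n) lower_scale R * (w T0 t / w T0 i) *
         (2^-1 - d%:R * z t om)
       < - ln p].
Proof.
move=> p0.
pose h t x := if (t < i)%N then 1 else
  expR (lower_scale R * (w T0 t / w T0 i) * (2^-1 - d%:R * x)).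
have mh t : measurable_fun setT (h t).
  rewrite /h; case: (t < i)%N => //.
  apply: measurableT_comp => //; apply: measurable_funM => //.
  by apply: measurable_funB => //; exact: measurable_funM.
have h0 t x : 0 <= h t x by rewrite /h; case: ifP => // _; exact: expR_ge0.
have hle t (b : d.-tuple R) : (t < T)%N -> sqn b = 1 ->
    (\int[gauss d]_v (h t (zeta v b))%:E <= 1)%E.
  move=> _ b1; rewrite /h; have [ti|it] := ltnP t i.
    by rewrite integral_prob_cst.
  apply: zeta_lower_mgf_scale => //.
  have w1 : w T0 t / w T0 i <= 1.
    by rewrite ler_pdivrMr ?w_gt0// mul1r w_nonincreasing.
  have s0 := lower_scale_gt0 R.
  rewrite mulr_ge0 ?divr_ge0 ?(ltW s0) ?(ltW (w_gt0 T0_ge1 _))//=.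
  by rewrite ler_piMr// ltW.
have pV0 : 0 < p^-1 by rewrite invr_gt0.
have [E [mE PE hE]] := zeta_maximal filtF model mh h0 hle pV0.
exists E; split => //; first by rewrite invrK in PE.
move=> om nE n /andP[iN nT]; have := hE om nE n nT.
rewrite prod_expR_from// => h1.
by rewrite -lnV ?posrE// -ltr_expR lnK// posrE.
Qed.

Lemma upper_tail_event (p : R) : 0 < p -> exists E : set Omega,
  [/\ measurable E, (P E <= p%:E)%E &
   forall om, ~ E om -> forall n, (n <= T)%N ->
     \sum_(0 <= t < n) 32^-1 * (T0 * w T0 t) * (d%:R * z t om - 96) < - ln p].
Proof.
move=> p0.
pose h t x := expR (32^-1 * (T0 * w T0 t) * (d%:R * x - 96)).
have mh t : measurable_fun setT (h t).
  apply: measurableT_comp => //; apply: measurable_funM => //.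
  by apply: measurable_funB => //; exact: measurable_funM.
have h0 t x : 0 <= h t x by exact: expR_ge0.
have hle t (b : d.-tuple R) : (t < T)%N -> sqn b = 1 ->
    (\int[gauss d]_v (h t (zeta v b))%:E <= 1)%E.
  move=> _ b1; apply: zeta_upper_mgf => //.
  have T00 : 0 < T0 by exact: lt_le_trans T0_ge1.
  have w1 : T0 * w T0 t <= 1 by rewrite ler_pdivrMr ?mul1r ?lerDr// ltr_wpDl.
  have w0 := w_gt0 T0_ge1 t.
  rewrite mulr_ge0 ?invr_ge0 ?mulr_ge0 ?(ltW w0) ?(ltW T00)//=.
  by rewrite ler_piMr// invr_ge0.
have pV0 : 0 < p^-1 by rewrite invr_gt0.
have [E [mE PE hE]] := zeta_maximal filtF model mh h0 hle pV0.
exists E; split => //; first by rewrite invrK in PE.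
move=> om nE n nT; have := hE om nE n nT.
rewrite /h -expR_sum => h1.
by rewrite -lnV ?posrE// -ltr_expR lnK// posrE.
Qed.

(** Union bound: half of delta goes to the upper tail, the other half is spread
over the left ends i in proportion to 1 / ((i+1) (i+2)). *)
Lemma good_event (delta : R) : 0 < delta < 1 -> exists E : set Omega,
  [/\ measurable E, ((1 - delta)%:E <= P E)%E &
  forall om, E om ->
    (forall i n, (i <= n <= T)%N -> (i < T)%N ->
     \sum_(i <= t < n) lower_scale R * (w T0 t / w T0 i) *
         (2^-1 - d%:R * z t om)
       < - ln (delta / 2 * (i.+1%:R * i.+2%:R)^-1)) /\
    (forall n, (n <= T)%N ->
     \sum_(0 <= t < n) 32^-1 * (T0 * w T0 t) * (d%:R * z t om - 96)
       < - ln (delta / 2))].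
Proof.
move=> /andP[d0 d1].
have p0 : 0 < delta / 2 by rewrite divr_gt0.
pose q i : R := delta / 2 * (i.+1%:R * i.+2%:R)^-1.
have q0 i : 0 < q i by rewrite mulr_gt0// invr_gt0 mulr_gt0.
have [U [mU PU hU]] := upper_tail_event p0.
have /choice[L hL] : forall i, exists E : set Omega,
  [/\ measurable E, (P E <= (q i)%:E)%E &
   forall om, ~ E om -> forall n, (i <= n <= T)%N ->
     \sum_(i <= t < n) lower_scale R * (w T0 t / w T0 i) *
         (2^-1 - d%:R * z t om)
       < - ln (q i)] by move=> i; exact: lower_tail_event.
pose B := \big[setU/set0]_(i < T) L i.
have mB : measurable B by apply: bigsetU_measurable => i _; have [] := hL i.
have PB : (P B <= (delta / 2)%:E)%E.
  apply: (le_trans (Boole_inequality P _)).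
    by move=> i _; have [] := hL i.
  apply: (@le_trans _ _ (\sum_(i < T) (q i)%:E)%E).
    by apply: lee_sum => i _; have [] := hL i.
  rewrite sumEFin lee_fin /q -mulr_sumr -[leRHS]mulr1.
  rewrite ler_wpM2l//; first exact: ltW.
  by have := @telescope_le1 R T; rewrite big_mkord.
exists (~` (B `|` U)); split.
- by apply: measurableC; exact: measurableU.
- rewrite probability_setC; last exact: measurableU.
  rewrite EFinB; apply: leeB => //.
  apply: (le_trans (measureU2 _ mB mU)).
  by rewrite [delta]splitr EFinD leeD.
- move=> om /not_orP[nB nU]; split; last by move=> n; exact: hU.
  move=> i n iN iT; have [_ _ h] := hL i; apply: h => //.
  move=> Li; apply: nB; rewrite /B -bigcup_mkord.
  by exists i.
Qed.

End good_events.

(** * From bounds on exponents to the weighted sums *)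

Section from_exponents_to_sums.
Context {R : realType}.
Variables (d T : nat) (T0 delta : R) (z : nat -> R).
Hypotheses (d_gt0 : (0 < d)%N) (T_gt0 : (1 <= T)%N) (T0_ge1 : 1 <= T0).
Hypotheses (delta_gt0 : 0 < delta) (delta_lt1 : delta < 1).

Let T0_gt0 : 0 < T0. Proof. exact: lt_le_trans T0_ge1. Qed.

Let dR_gt0 : 0 < d%:R :> R. Proof. by rewrite ltr0n. Qed.

Let Gam := Gamma_scan T T0 delta.

Let Gam_ge : 1 + ln (1 / delta) + ln (expR 1 + T0) <= Gam.
Proof. exact: Gamma_ge. Qed.

Let ln_delta_ge0 : 0 <= ln (1 / delta).
Proof. by rewrite ln_ge0// ler_pdivlMr// mul1r ltW. Qed.

Let ln_eT0_ge0 : 0 <= ln (expR 1 + T0).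
Proof. by rewrite ln_ge0// (le_trans T0_ge1)// lerDr expR_ge0. Qed.

Let ln2_le1 : ln 2 <= 1 :> R.
Proof.
have -> : 2 = 1 + 1 :> R by lra.
by apply: le_ln1Dx; lra.
Qed.

Let neg_ln_half_delta : - ln (delta / 2) = ln 2 + ln (1 / delta).
Proof. by rewrite !ln_div ?posrE// ln1; ring. Qed.

(** The logarithm of the confidence level at i grows like 2 ln i, which the
decay of the weight 1 / (i + T0) compensates; see [start_penalty]. *)
Lemma start_confidence_cost (i : nat) :
  T0 * - ln (delta / 2 * (i.+1%:R * i.+2%:R)^-1) <= (i%:R + T0) * (5 * Gam).
Proof.
have i1 : 0 < i.+1%:R :> R by [].
have i2 : 0 < i.+2%:R :> R by [].
have -> : - ln (delta / 2 * (i.+1%:R * i.+2%:R)^-1) =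
    ln 2 + ln (1 / delta) + (ln i.+1%:R + ln i.+2%:R).
  rewrite -neg_ln_half_delta -lnM ?posrE//.
  rewrite lnM ?posrE ?invr_gt0 ?mulr_gt0 ?invr_gt0//.
  by rewrite (lnV (x := i.+1%:R * i.+2%:R)) ?posrE ?mulr_gt0// opprB addrC.
have h1 := start_penalty T0_ge1 i.
have h2 : ln i.+1%:R <= ln i.+2%:R :> R by rewrite ler_ln ?posrE// ler_nat.
have h3 := ler_wpM2l (ltW T0_gt0) h2.
have h4 : T0 * (ln 2 + ln (1 / delta)) <= (i%:R + T0) * (1 + ln (1 / delta)).
  apply: ler_pM; first exact: ltW.
  - by rewrite addr_ge0// ln_ge0//; lra.
  - by rewrite lerDr.
  - by rewrite lerD2r.
have h5 : (i%:R + T0) * (5 + 2 * ln (expR 1 + T0) + ln (1 / delta)) <=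
    (i%:R + T0) * (5 * Gam).
  apply: ler_wpM2l; first by rewrite addr_ge0// ltW.
  by move: Gam_ge ln_delta_ge0 ln_eT0_ge0; lra.
apply: le_trans h5.
move: h1 h3 h4; move: (ln _) (ln _) (ln _) (ln _) (ln _) => A B C' D E; lra.
Qed.

(** The exponent equals lower_scale * (i + T0) * (S / 2 - d Z), where S and Z
are the sums of w_t and of w_t zeta_t; the factor i + T0 cancels against the one
in [start_confidence_cost]. *)
Lemma lower_bound_from_exponent (C : R) (i n : nat) :
  5 / lower_scale R <= C ->
  \sum_(i <= t < n) lower_scale R * (w T0 t / w T0 i) * (2^-1 - d%:R * z t)
    < - ln (delta / 2 * (i.+1%:R * i.+2%:R)^-1) ->
  1 / (2 * d%:R) * (\sum_(i <= t < n) w T0 t) - C / (d%:R * T0) * Gam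
    <= \sum_(i <= t < n) w T0 t * z t.
Proof.
move=> C5; set S := \sum_(i <= t < n) w T0 t.
set Z := \sum_(i <= t < n) w T0 t * z t.
have s0 := lower_scale_gt0 R.
have iT0 : 0 < i%:R + T0 by rewrite ltr_wpDl.
have Gam0 : 0 <= Gam by move: Gam_ge ln_delta_ge0 ln_eT0_ge0; lra.
have -> : \sum_(i <= t < n) lower_scale R * (w T0 t / w T0 i) *
    (2^-1 - d%:R * z t) = lower_scale R * (i%:R + T0) * (S / 2 - d%:R * Z).
  rewrite /S /Z mulr_suml mulr_sumr -sumrB mulr_sumr.
  by apply: eq_bigr => t _; rewrite {2}/w invrK; ring.
move=> /ltW /(ler_wpM2l (ltW T0_gt0)) /le_trans /(_ (start_confidence_cost i)).
rewrite (_ : T0 * _ = (i%:R + T0) * (lower_scale R * T0 * (S / 2 - d%:R * Z)));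
  last by ring.
rewrite ler_pM2l// => h.
have h1 : T0 * (S / 2 - d%:R * Z) <= C * Gam.
  apply: (@le_trans _ _ (5 / lower_scale R * Gam)); last by rewrite ler_wpM2r.
  rewrite -(ler_pM2l s0) (le_trans _ (le_trans h _))//.
    by rewrite mulrA.
  by rewrite mulrA (mulrCA _ 5) divff ?mulr1// gt_eqF.
rewrite -subr_ge0 -(@pmulr_rge0 _ (d%:R * T0)) ?mulr_gt0//.
rewrite [leRHS](_ : _ = C * Gam - T0 * (S / 2 - d%:R * Z)) ?subr_ge0//.
by field; rewrite !gt_eqF.
Qed.

Lemma upper_bound_from_exponent (C : R) (K : nat) :
  96 <= C -> (K <= T)%N ->
  \sum_(0 <= t < K) 32^-1 * (T0 * w T0 t) * (d%:R * z t - 96)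
    < - ln (delta / 2) ->
  d%:R * (\sum_(0 <= t < K) w T0 t * z t)
    <= C * (1 + ln (T%:R + T0)) + C / T0 * Gam.
Proof.
move=> C96 KT; set Z := \sum_(0 <= t < K) w T0 t * z t.
have -> : \sum_(0 <= t < K) 32^-1 * (T0 * w T0 t) * (d%:R * z t - 96) =
    32^-1 * T0 * (d%:R * Z - 96 * \sum_(0 <= t < K) w T0 t).
  rewrite /Z mulr_sumr mulr_sumr -sumrB mulr_sumr.
  by apply: eq_bigr => t _; ring.
have := sum_w_le T0_ge1 KT; set S := \sum_(0 <= t < K) w T0 t => hS.
have S0 : 0 <= S by apply: sumr_ge0 => t _; rewrite ltW// w_gt0.
rewrite neg_ln_half_delta => h.
have h1 : T0 * (d%:R * Z - 96 * S) <= C * Gam.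
  apply: (@le_trans _ _ (32 * Gam)).
    by move: h Gam_ge ln2_le1 ln_eT0_ge0; lra.
  apply: ler_wpM2r; last by lra.
  by move: Gam_ge ln_delta_ge0 ln_eT0_ge0; lra.
have h2 : 96 * S <= C * (1 + ln (T%:R + T0)) by apply: ler_pM => //.
have h3 : d%:R * Z - 96 * S <= C / T0 * Gam.
  by rewrite mulrAC ler_pdivlMr// mulrC.
by lra.
Qed.

End from_exponents_to_sums.

(* F n stands for the sigma-algebra F_{n-1} of the filtration (F_t)_{t >= -1}. *)
Theorem lemma19 (R : realType) :
  exists2 C : R, 0 < C &
  forall (T d : nat) (T0 delta : R),
    (1 <= T)%N -> (1 <= d)%N -> 1 <= T0 -> 0 < delta < 1 ->
  forall (disp : measure_display) (Omega : measurableType disp)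
    (P : probability Omega R) (F : nat -> set (set Omega))
    (a u : nat -> Omega -> d.-tuple R),
    filtration F ->
    (forall t, (t < T)%N ->
       [/\ adapted_to (F t) (a t),
           forall om, enorm (a t om) = 1,
           adapted_to (F t.+1) (u t),
           has_law P (u t) (@std_gaussian R d) &
           independent_of P (F t) (u t)]) ->
  let z t om := zeta (u t om) (a t om) in
  let Gam := Gamma_scan T T0 delta in
  exists E : set Omega,
    [/\ measurable E, ((1 - delta)%:E <= P E)%E &
    forall om, E om ->
    [/\ forall i j : nat, (i <= j <= T - 1)%N ->
          \sum_(i <= t < j.+1) w T0 t * z t om
            >= 1 / (2 * d%:R) * (\sum_(i <= t < j.+1) w T0 t)
               - C / (d%:R * T0) * Gam,
        forall K : nat, (1 <= K <= T)%N ->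
          d%:R * (\sum_(0 <= t < K) w T0 t * z t om)
            <= C * (1 + ln (T%:R + T0)) + C / T0 * Gam &
        forall (K : nat) (k : int), (1 <= K <= T)%N ->
          -1 <= k <= K%:Z - 2 ->
          \sum_(0 <= t < K | k + 1 <= t%:Z) z t om / (t%:R + T0)
            >= W T0 K k / (2 * d%:R) - C / (d%:R * T0) * Gam]].
Proof.
have s0 := lower_scale_gt0 R.
pose C : R := 5 / lower_scale R + 96.
have C5 : 5 / lower_scale R <= C by rewrite /C lerDl.
have C96 : 96 <= C by rewrite /C lerDr divr_ge0// ltW.
exists C; first by rewrite (lt_le_trans _ C96).
move=> T d T0 delta T1 d1 T01 delta01 disp Omega P F a u filtF model z Gam.
have [E [mE PE hE]] := good_event d1 T01 filtF model delta01.
have [delta0 delta1] := andP delta01.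
exists E; split => // om /hE[lower upper].
have part1 i j : (i <= j <= T - 1)%N ->
    1 / (2 * d%:R) * (\sum_(i <= t < j.+1) w T0 t) - C / (d%:R * T0) * Gam
      <= \sum_(i <= t < j.+1) w T0 t * z t om.
  move=> /andP[ij jT].
  have jT' : (j < T)%N by rewrite (leq_ltn_trans jT)// subn1 ltn_predL.
  apply: (lower_bound_from_exponent (z := fun t => z t om)) => //.
  by apply: lower; rewrite ?(leq_ltn_trans ij)//= leqW.
split => //.
- move=> K /andP[_ KT].
  apply: (upper_bound_from_exponent (z := fun t => z t om)) => //.
  exact: upper.
- move=> K k /andP[K1 KT] /andP[k1 kK].
  have [i iE] : exists i : nat, k + 1 = i%:Z.
    by exists (absz (k + 1)); rewrite gez0_abs//; lia.
  have iK : (i <= K.-1 <= T - 1)%N by lia.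
  rewrite /W iE !sum_filter_from -[K in leRHS]prednK// -[K in leLHS]prednK//.
  rewrite [leRHS](eq_bigr (fun t => w T0 t * z t om)) => [|t _]; last first.
    by rewrite mulrC.
  rewrite [X in X / _](eq_bigr (w T0)) => [|t _]; last by rewrite mul1r.
  by rewrite mulrC -[_^-1]mul1r; exact: part1.
Qed.
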